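(* Let $k\in\{1,2,3,\dots\}$, $\alpha\in(0,2]$, and let $c_{-k}$ be a real number with $c_{-k}\in(-N,N)$, where $$N=\frac{\alpha}{2\left(\dfrac{(k-\frac{\alpha}{2})\,\Gamma(k+1)\,\Gamma(2+\frac{\alpha}{2})}{\Gamma(k+1+\frac{\alpha}{2})}+k\right)}.$$ Then the real kernel $\alpha$-harmonic mapping $$u(z)=F_{1}(|z|^2)\,z+c_{-k}F_{k}(|z|^2)\,\overline{z}^{k}$$ is sense-preserving and univalent in the open unit disk $\mathbb{D}$.
   Context: For $j=1,2,\dots$ and $t\in[0,1)$, $F_{j}(t)=F\left(-\tfrac{\alpha}{2},j-\tfrac{\alpha}{2};j+1;t\right)$, where $F(a,b;c;x)=\sum_{n=0}^{\infty}\frac{(a)_n(b)_n}{(c)_n}\frac{x^n}{n!}$ is the Gauss hypergeometric function, with $(a)_0=1$ and $(a)_n=a(a+1)\cdots(a+n-1)$ for $n\ge1$. $\Gamma$ is the Gamma function. Sense-preserving means $|u_z|>|u_{\bar z}|$ in $\mathbb{D}$ (positive Jacobian); univalent means injective. *)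

(* Defs.v *)
From Stdlib Require Import Reals Factorial.
From Coquelicot Require Import Coquelicot.
Open Scope R_scope.

Definition Gamma (x : R) : R :=
  RInt_gen (fun t => Rpower t (x - 1) * exp (- t))
           (at_right 0) (Rbar_locally p_infty).

(* Rising factorial (a)_n = a (a+1) ... (a+n-1). *)
Fixpoint pochhammer (a : R) (n : nat) : R :=
  match n with
  | O => 1
  | S m => pochhammer a m * (a + INR m)
  end.

(* [Series] takes an arbitrary value on divergent series; the Gauss series is
   only used here for |x| < 1 and c a positive integer, where it converges. *)
Definition hypergeom (a b c x : R) : R :=
  Series (fun n => pochhammer a n * pochhammer b n / pochhammer c n
                   * (x ^ n / INR (fact n))).

Definition Fj (alpha : R) (j : nat) (t : R) : R :=
  hypergeom (- (alpha / 2)) (INR j - alpha / 2) (INR j + 1) t.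

Definition unit_disk (z : C) : Prop := Cmod z < 1.

(* Partial derivatives of u : C -> C in x and y, where z = x + i y. *)
Definition partial_x (u : C -> C) (z : C) : C :=
  (Derive (fun x => Re (u (x, Im z))) (Re z),
   Derive (fun x => Im (u (x, Im z))) (Re z)).

Definition partial_y (u : C -> C) (z : C) : C :=
  (Derive (fun y => Re (u (Re z, y))) (Im z),
   Derive (fun y => Im (u (Re z, y))) (Im z)).

Definition d_z (u : C -> C) (z : C) : C :=
  ((partial_x u z - Ci * partial_y u z) / 2)%C.

Definition d_zbar (u : C -> C) (z : C) : C :=
  ((partial_x u z + Ci * partial_y u z) / 2)%C.

(* Differentiability is over R; it is required because [Derive] is a total
   function, meaningless where the derivative does not exist. *)
Definition sense_preserving_on (D : C -> Prop) (u : C -> C) : Prop :=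
  forall z : C, D z ->
    @ex_filterdiff R_AbsRing C_R_NormedModule C_R_NormedModule u (locally z)
    /\ Cmod (d_zbar u z) < Cmod (d_z u z).

Definition univalent_on (D : C -> Prop) (u : C -> C) : Prop :=
  forall z w : C, D z -> D w -> u z = u w -> z = w.

(* Main.v *)
(* Write a = alpha/2, t = |z|^2, and F_j for the Gauss series. All Taylor coefficients of F_j
   but the constant one are nonpositive, and comparing them with those of (1 - t)^a, whose partial
   sums at t = 1 telescope to nonnegative numbers, gives F_j > 0, F_j' <= 0, k F_k + t F_k' >= 0
   and F_k <= F_1 on [0, 1). Another telescoping sum gives F_1 + 2 t F_1' >= a F_1. The hypothesis
   on c is only used through |c| k < a. Then |u_z| - |u_zbar| >= F_1 + 2 t F_1' - |c| k F_k > 0.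

   For univalence put R_j(r) = r^j F_j(r^2), so that u(r e) = R_1(r) e + c R_k(r) conj(e)^k when
   |e| = 1. The estimates above give a |R_k'| <= k R_1' and R_k <= R_1, and from
   |p e - q f|^2 = (p - q)^2 + p q |e - f|^2 together with |e^k - f^k| <= k |e - f| one sees that
   the second term of u is a strict contraction with respect to the injective first term. *)

Require Import Defs.
From Stdlib Require Import Reals Lra Lia Factorial Classical FunctionalExtensionality.
From Coquelicot Require Import Coquelicot.
Open Scope R_scope.

(** * Gauss series *)

(* [sum_Sn] restated because [ring] and [lra] do not see through the abstract [plus]. *)
Lemma sum_n_S_R (f : nat -> R) (M : nat) : sum_n f (S M) = sum_n f M + f (S M) :> R.
Proof. exact (sum_Sn f M). Qed.

Lemma pochhammer_S_left (x : R) (n : nat) :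
  pochhammer x (S n) = x * pochhammer (x + 1) n.
Proof.
  induction n as [|n IH]; [simpl; ring|].
  change (pochhammer x (S n) * (x + INR (S n)) =
          x * (pochhammer (x + 1) n * (x + 1 + INR n))).
  rewrite IH, S_INR; ring.
Qed.

Lemma pochhammer_ge_0 (x : R) (n : nat) : 0 <= x -> 0 <= pochhammer x n.
Proof.
  intros Hx; induction n as [|n IH]; simpl; [lra|].
  pose proof (pos_INR n); nra.
Qed.

Lemma pochhammer_gt_0 (x : R) (n : nat) : 0 < x -> 0 < pochhammer x n.
Proof.
  intros Hx; induction n as [|n IH]; simpl; [lra|].
  pose proof (pos_INR n); nra.
Qed.

Lemma pochhammer_le (x y : R) (n : nat) :
  0 <= x <= y -> pochhammer x n <= pochhammer y n.
Proof.
  intros Hxy; induction n as [|n IH]; simpl; [lra|].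
  pose proof (pos_INR n).
  apply Rmult_le_compat; try lra.
  apply pochhammer_ge_0; lra.
Qed.

Lemma pochhammer_1 (n : nat) : pochhammer 1 n = INR (fact n).
Proof.
  induction n as [|n IH]; [reflexivity|].
  change (pochhammer 1 n * (1 + INR n) = INR (fact (S n))).
  rewrite IH, fact_simpl, mult_INR, S_INR; ring.
Qed.

Definition hyp_coef (a b c : R) (n : nat) : R :=
  pochhammer a n * pochhammer b n / pochhammer c n / INR (fact n).

Lemma hypergeom_PSeries (a b c x : R) :
  hypergeom a b c x = PSeries (hyp_coef a b c) x.
Proof.
  apply Series_ext; intros n; unfold hyp_coef, Rdiv; ring.
Qed.

Lemma hyp_coef_0 (a b c : R) : hyp_coef a b c 0 = 1.
Proof. unfold hyp_coef; simpl; field. Qed.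

Definition Fcoef (a j : R) : nat -> R := hyp_coef (- a) (j - a) (j + 1).

(* [(-a)_n / n!], the Taylor coefficients of [(1 - t)^a]. *)
Definition binom_coef (a : R) (n : nat) : R := pochhammer (- a) n / INR (fact n).

Lemma binom_coef_S (a : R) (n : nat) :
  binom_coef a (S n) = - (a * (pochhammer (1 - a) n / INR (fact (S n)))).
Proof.
  unfold binom_coef; rewrite pochhammer_S_left.
  replace (- a + 1) with (1 - a) by ring; unfold Rdiv; ring.
Qed.

(** Once the factor [- a] is split off, the rest is (1 - a)_n / (n + 1)!. As 1 - a lies between 0
    and 1, the numerator is between 0 and (1)_n = n!. *)
Lemma binom_coef_S_bounds (a : R) (n : nat) :
  0 < a <= 1 -> - 1 <= binom_coef a (S n) <= 0.
Proof.
  intros Ha; rewrite binom_coef_S.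
  assert (H : 0 <= pochhammer (1 - a) n / INR (fact (S n)) <= 1).
  { pose proof (INR_fact_lt_0 (S n)).
    pose proof (pochhammer_ge_0 (1 - a) n ltac:(lra)).
    pose proof (pochhammer_le (1 - a) 1 n ltac:(lra)) as Hle.
    rewrite pochhammer_1 in Hle.
    assert (INR (fact n) <= INR (fact (S n))).
    { apply le_INR, fact_le; lia. }
    split; [apply Rdiv_le_0_compat; lra|].
    apply Rle_div_l; lra. }
  nra.
Qed.

(** Taking partial sums of coefficients amounts to dividing by 1 - t, and (1 - t)^(a - 1) has the
    coefficients (1 - a)_n / n!. *)
Lemma sum_binom_coef (a : R) (M : nat) :
  sum_n (binom_coef a) M = pochhammer (1 - a) M / INR (fact M) :> R.
Proof.
  induction M as [|M IH].
  - rewrite sum_O; unfold binom_coef; simpl; field.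
  - rewrite sum_n_S_R, IH, binom_coef_S, fact_simpl, mult_INR, S_INR.
    simpl pochhammer; pose proof (pos_INR M); pose proof (INR_fact_lt_0 M).
    field; split; lra.
Qed.

Lemma Fcoef_binom (a j : R) (n : nat) :
  Fcoef a j n = binom_coef a n * (pochhammer (j - a) n / pochhammer (j + 1) n).
Proof. unfold Fcoef, hyp_coef, binom_coef, Rdiv; ring. Qed.

Lemma pochhammer_ratio_bounds (x y : R) (n : nat) :
  0 <= x <= y -> 0 < y -> 0 <= pochhammer x n / pochhammer y n <= 1.
Proof.
  intros Hxy Hy.
  pose proof (pochhammer_gt_0 y n Hy).
  pose proof (pochhammer_ge_0 x n ltac:(lra)).
  pose proof (pochhammer_le x y n Hxy).
  split; [apply Rdiv_le_0_compat; lra|apply Rle_div_l; lra].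
Qed.

Lemma Fcoef_S_bounds (a j : R) (n : nat) :
  0 < a <= 1 -> 1 <= j -> - 1 <= Fcoef a j (S n) <= 0.
Proof.
  intros Ha Hj; rewrite Fcoef_binom.
  pose proof (binom_coef_S_bounds a n Ha).
  pose proof (pochhammer_ratio_bounds (j - a) (j + 1) (S n) ltac:(lra) ltac:(lra)).
  nra.
Qed.

(** Since [binom_coef a n] is nonpositive for n >= 1, it suffices that (j - a)_n / (j + 1)_n grows
    with j. This holds factor by factor: (j - a + i) / (j + 1 + i) = 1 - (a + 1) / (j + 1 + i). *)
Lemma Fcoef_le (a j : R) (n : nat) :
  0 < a <= 1 -> 1 <= j -> Fcoef a j n <= Fcoef a 1 n.
Proof.
  intros Ha Hj.
  destruct n as [|n]; [unfold Fcoef; rewrite !hyp_coef_0; lra|].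
  rewrite !Fcoef_binom.
  apply Rmult_le_compat_neg_l; [apply binom_coef_S_bounds, Ha|].
  generalize (S n); clear n; intros n.
  induction n as [|n IH]; [simpl; lra|].
  simpl pochhammer.
  pose proof (pos_INR n).
  pose proof (pochhammer_gt_0 (1 + 1) n ltac:(lra)).
  pose proof (pochhammer_gt_0 (j + 1) n ltac:(lra)).
  assert (Hdiv : forall p q r s, r <> 0 -> s <> 0 -> p * q / (r * s) = p / r * (q / s))
    by (intros; field; split; assumption).
  rewrite !Hdiv by lra.
  apply Rmult_le_compat; [| |exact IH|].
  - apply pochhammer_ratio_bounds; lra.
  - apply Rdiv_le_0_compat; lra.
  - apply Rle_div_l; [lra|].
    replace ((j - a + INR n) / (j + 1 + INR n) * (1 + 1 + INR n))
      with ((j - a + INR n) * (1 + 1 + INR n) / (j + 1 + INR n)) by (field; lra).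
    apply Rle_div_r; [lra|nra].
Qed.

(** * Power series with nonpositive higher coefficients *)

Lemma PSeries_le (f g : nat -> R) (t : R) :
  0 <= t -> ex_series (fun n => f n * t ^ n) -> ex_series (fun n => g n * t ^ n) ->
  (forall n, f n <= g n) -> PSeries f t <= PSeries g t.
Proof.
  intros Ht Hf Hg Hfg.
  apply (is_lim_seq_le (sum_n (fun n => f n * t ^ n)) (sum_n (fun n => g n * t ^ n))
           (PSeries f t) (PSeries g t)).
  - intros M; apply sum_n_m_le; intros n.
    apply Rmult_le_compat_r; [apply pow_le, Ht|apply Hfg].
  - apply Series_correct, Hf.
  - apply Series_correct, Hg.
Qed.

(** For n >= 1 one has t^n <= t and f n <= 0, so replacing t^n by t only lowers a partial sum. The
    lowered sum is (1 - t) f 0 + t S_M, where S_M >= 0 is the partial sum at t = 1. *)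
Lemma PSeries_ge_of_sum_n_ge_0 (f : nat -> R) (t : R) :
  0 <= t < 1 -> ex_series (fun n => f n * t ^ n) ->
  (forall n, f (S n) <= 0) -> (forall M, 0 <= sum_n f M) ->
  f O * (1 - t) <= PSeries f t.
Proof.
  intros Ht Hf Hneg Hsum.
  assert (Hpart : forall M, f O + t * (sum_n f M - f O)
                            <= sum_n (fun n => f n * t ^ n) M).
  { induction M as [|M IH].
    - rewrite !sum_O; simpl; lra.
    - rewrite !sum_n_S_R.
      assert (t ^ S M <= t).
      { simpl; pose proof (pow_le t M ltac:(lra)).
        pose proof (pow_incr t 1 M ltac:(lra)) as H1; rewrite pow1 in H1; nra. }
      pose proof (Hneg M); nra. }
  apply (is_lim_seq_le (fun _ => f O * (1 - t)) (sum_n (fun n => f n * t ^ n))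
           (f O * (1 - t)) (PSeries f t)).
  - intros M; pose proof (Hpart M); pose proof (Hsum M); nra.
  - apply is_lim_seq_const.
  - apply Series_correct, Hf.
Qed.

Lemma CV_radius_bounded_coef (f : nat -> R) (B t : R) :
  (forall n, Rabs (f n) <= B) -> Rabs t < 1 -> Rbar_lt (Rabs t) (CV_radius f).
Proof.
  intros Hf Ht.
  apply (Rbar_lt_le_trans _ 1); [exact Ht|].
  apply CV_radius_bounded; exists B; intros n.
  rewrite pow1, Rmult_1_r; apply Hf.
Qed.

Lemma ex_pseries_series (f : nat -> R) (t : R) :
  ex_pseries f t -> ex_series (fun n => f n * t ^ n).
Proof. apply ex_series_ext; intros n; rewrite <- pow_n_pow; apply Rmult_comm. Qed.

(** The effect on coefficients of the Euler operator m + v t d/dt. The pairs (j, 1) and (1 - a, 2)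
    are the ones used below. *)
Definition PS_euler (m v : R) (f : nat -> R) (n : nat) : R := (m + v * INR n) * f n.

Lemma PSeries_euler (f : nat -> R) (m v t : R) :
  Rbar_lt (Rabs t) (CV_radius f) ->
  ex_series (fun n => PS_euler m v f n * t ^ n) /\
  PSeries (PS_euler m v f) t = m * PSeries f t + v * (t * PSeries (PS_derive f) t).
Proof.
  intros Ht.
  set (g := PS_plus (PS_scal m f) (PS_scal v (PS_incr_1 (PS_derive f)))).
  assert (Hg : forall n, g n = PS_euler m v f n).
  { intros n; unfold g, PS_euler, PS_plus, PS_scal, PS_incr_1, PS_derive.
    unfold plus, scal; simpl; unfold mult; simpl.
    destruct n; simpl INR; [unfold zero; simpl|]; ring. }
  assert (H1 : ex_pseries (PS_scal m f) t).
  { apply ex_pseries_scal; [apply Rmult_comm|apply CV_radius_inside, Ht]. }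
  assert (H2 : ex_pseries (PS_scal v (PS_incr_1 (PS_derive f))) t).
  { apply ex_pseries_scal; [apply Rmult_comm|].
    apply ex_pseries_incr_1, ex_pseries_derive, Ht. }
  split.
  - apply (ex_series_ext (fun n => g n * t ^ n)); [intros n; now rewrite Hg|].
    now apply ex_pseries_series, ex_pseries_plus.
  - rewrite <- (PSeries_ext g _ t Hg); unfold g.
    now rewrite PSeries_plus, !PSeries_scal, PSeries_incr_1.
Qed.

(** * Estimates for F_j and its derivative on [0, 1) *)

Definition Fser (a j t : R) : R := PSeries (Fcoef a j) t.
Definition dFser (a j t : R) : R := PSeries (PS_derive (Fcoef a j)) t.

Lemma Fcoef_CV (a j t : R) :
  0 < a <= 1 -> 1 <= j -> Rabs t < 1 ->
  Rbar_lt (Rabs t) (CV_radius (Fcoef a j)).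
Proof.
  intros Ha Hj; apply CV_radius_bounded_coef with (B := 1); intros [|n].
  - unfold Fcoef; rewrite hyp_coef_0, Rabs_R1; lra.
  - apply Rabs_le; pose proof (Fcoef_S_bounds a j n Ha Hj); lra.
Qed.

Lemma Fser_derive (a j t : R) :
  0 < a <= 1 -> 1 <= j -> Rabs t < 1 -> is_derive (Fser a j) t (dFser a j t).
Proof. intros Ha Hj Ht; apply is_derive_PSeries, Fcoef_CV; assumption. Qed.

(** Each coefficient is that of (1 - t)^a times a ratio in [0, 1]. For n >= 1 the former is
    nonpositive, so the ratio can only raise it, and the partial sums at t = 1 stay above those of
    (1 - t)^a, which are nonnegative. *)
Lemma Fser_ge (a j t : R) :
  0 < a <= 1 -> 1 <= j -> 0 <= t < 1 -> 1 - t <= Fser a j t.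
Proof.
  intros Ha Hj Ht.
  replace (1 - t) with (Fcoef a j 0 * (1 - t)) by (unfold Fcoef; rewrite hyp_coef_0; ring).
  apply PSeries_ge_of_sum_n_ge_0; [exact Ht| | |].
  - apply ex_pseries_series, CV_radius_inside, Fcoef_CV; [exact Ha|exact Hj|].
    rewrite Rabs_pos_eq; lra.
  - intros n; apply Fcoef_S_bounds; assumption.
  - intros M; apply Rle_trans with (sum_n (binom_coef a) M).
    + rewrite sum_binom_coef; apply Rdiv_le_0_compat; [|apply INR_fact_lt_0].
      apply pochhammer_ge_0; lra.
    + apply sum_n_m_le; intros [|n].
      * unfold Fcoef; rewrite hyp_coef_0; unfold binom_coef; simpl; lra.
      * rewrite Fcoef_binom; pose proof (binom_coef_S_bounds a n Ha).
        pose proof (pochhammer_ratio_bounds (j - a) (j + 1) (S n) ltac:(lra) ltac:(lra)).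
        nra.
Qed.

(* [j F_j + t F_j'] is [j F(-a, j - a; j; t)]. *)
Lemma Fser_euler_ge_0 (a j t : R) :
  0 < a <= 1 -> 1 <= j -> 0 <= t < 1 -> 0 <= j * Fser a j t + t * dFser a j t.
Proof.
  intros Ha Hj Ht.
  destruct (PSeries_euler (Fcoef a j) j 1 t) as [Hex Heq].
  { apply Fcoef_CV; [exact Ha|exact Hj|rewrite Rabs_pos_eq; lra]. }
  replace (j * Fser a j t + t * dFser a j t) with (PSeries (PS_euler j 1 (Fcoef a j)) t)
    by (rewrite Heq; unfold Fser, dFser; ring).
  (* The factor j + n from the Euler operator lowers the bottom parameter from j + 1 to j, because
     (j)_n (j + n) = j (j + 1)_n. *)
  assert (Hc : forall n, PS_euler j 1 (Fcoef a j) n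
    = j * (binom_coef a n * (pochhammer (j - a) n / pochhammer j n))).
  { intros n; unfold PS_euler; rewrite Fcoef_binom.
    pose proof (pochhammer_gt_0 (j + 1) n ltac:(lra)).
    pose proof (pochhammer_gt_0 j n ltac:(lra)).
    assert (Hs : pochhammer j n * (j + INR n) = j * pochhammer (j + 1) n)
      by apply (pochhammer_S_left j n).
    assert (Hq : / pochhammer j n = (j + INR n) / (j * pochhammer (j + 1) n)).
    { rewrite <- Hs; pose proof (pos_INR n); field; split; lra. }
    unfold Rdiv at 2; rewrite Hq; field; split; lra. }
  apply Rle_trans with (PS_euler j 1 (Fcoef a j) 0 * (1 - t)).
  - rewrite Hc; unfold binom_coef; simpl.
    replace (j * (1 / 1 * (1 / 1))) with j by field; nra.
  - apply PSeries_ge_of_sum_n_ge_0; [exact Ht|exact Hex| |].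
    + intros n; rewrite Hc; pose proof (binom_coef_S_bounds a n Ha).
      pose proof (pochhammer_ratio_bounds (j - a) j (S n) ltac:(lra) ltac:(lra)).
      rewrite <- (Rmult_0_r j); apply Rmult_le_compat_l; nra.
    + intros M; apply Rle_trans with (sum_n (fun n => scal j (binom_coef a n)) M).
      * rewrite sum_n_scal_l; apply Rmult_le_pos; [lra|].
        rewrite sum_binom_coef; apply Rdiv_le_0_compat; [|apply INR_fact_lt_0].
        apply pochhammer_ge_0; lra.
      * apply sum_n_m_le; intros n; rewrite Hc; apply Rmult_le_compat_l; [lra|].
        destruct n as [|n]; [simpl; lra|].
        pose proof (binom_coef_S_bounds a n Ha).
        pose proof (pochhammer_ratio_bounds (j - a) j (S n) ltac:(lra) ltac:(lra)).
        nra.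
Qed.

Lemma dFser_le_0 (a j t : R) :
  0 < a <= 1 -> 1 <= j -> 0 <= t < 1 -> dFser a j t <= 0.
Proof.
  intros Ha Hj Ht.
  replace 0 with (PSeries (fun _ => 0) t) by apply PSeries_const_0.
  apply PSeries_le; [lra| | |].
  - apply ex_pseries_series, ex_pseries_derive, Fcoef_CV; [exact Ha|exact Hj|].
    rewrite Rabs_pos_eq; lra.
  - apply (ex_series_ext (fun _ => 0)); [intros n; symmetry; apply Rmult_0_l|].
    exists 0; apply filterlim_ext with (f := fun _ : nat => 0).
    + intros n; rewrite sum_n_const; symmetry; apply Rmult_0_r.
    + apply filterlim_const.
  - intros n; unfold PS_derive; pose proof (pos_INR (S n)).
    pose proof (Fcoef_S_bounds a j n Ha Hj); nra.
Qed.

Lemma Fser_le_Fser_1 (a j t : R) :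
  0 < a <= 1 -> 1 <= j -> 0 <= t < 1 -> Fser a j t <= Fser a 1 t.
Proof.
  intros Ha Hj Ht; apply PSeries_le; [lra| | |].
  1, 2: apply ex_pseries_series, CV_radius_inside, Fcoef_CV;
    [exact Ha|lra|rewrite Rabs_pos_eq; lra].
  intros n; now apply Fcoef_le.
Qed.

(** The telescoping rests on (n - a)(n + 1 - a) - n (n + 1) = - a (1 - a + 2 n), whose last factor
    is the one contributed by [PS_euler (1 - a) 2]. *)
Lemma sum_euler_Fcoef_1 (a : R) (M : nat) :
  sum_n (PS_euler (1 - a) 2 (Fcoef a 1)) M
  = pochhammer (1 - a) M * pochhammer (1 - a) (S M) / (INR (fact M) * INR (fact (S M))) :> R.
Proof.
  assert (H2 : forall n, pochhammer (1 + 1) n = INR (fact (S n))).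
  { intros n; rewrite <- pochhammer_1, (pochhammer_S_left 1); ring. }
  induction M as [|M IH].
  - rewrite sum_O; unfold PS_euler, Fcoef; rewrite hyp_coef_0; simpl; field.
  - rewrite sum_n_S_R, IH.
    unfold PS_euler; rewrite Fcoef_binom, binom_coef_S, H2.
    change (pochhammer (1 - a) (S (S M)))
      with (pochhammer (1 - a) M * (1 - a + INR M) * (1 - a + INR (S M))).
    change (pochhammer (1 - a) (S M)) with (pochhammer (1 - a) M * (1 - a + INR M)).
    rewrite !fact_simpl, !mult_INR, !S_INR.
    pose proof (pos_INR M); pose proof (INR_fact_lt_0 M).
    field; repeat split; lra.
Qed.

(** Moving a F_1 to the other side leaves (1 - a) F_1 + 2 t F_1' >= 0, a series whose coefficients
    have nonnegative partial sums by the closed form above. *)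
Lemma Fser_1_radial_derive_ge (a t : R) :
  0 < a <= 1 -> 0 <= t < 1 -> a * Fser a 1 t <= Fser a 1 t + 2 * (t * dFser a 1 t).
Proof.
  intros Ha Ht.
  destruct (PSeries_euler (Fcoef a 1) (1 - a) 2 t) as [Hex Heq].
  { apply Fcoef_CV; [exact Ha|lra|rewrite Rabs_pos_eq; lra]. }
  assert (H : 0 <= PSeries (PS_euler (1 - a) 2 (Fcoef a 1)) t).
  { apply Rle_trans with (PS_euler (1 - a) 2 (Fcoef a 1) 0 * (1 - t)).
    - unfold PS_euler, Fcoef; rewrite hyp_coef_0; simpl; nra.
    - apply PSeries_ge_of_sum_n_ge_0; [exact Ht|exact Hex| |].
      + intros n; unfold PS_euler; pose proof (pos_INR (S n)).
        pose proof (Fcoef_S_bounds a 1 n Ha ltac:(lra)); nra.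
      + intros M; rewrite sum_euler_Fcoef_1; apply Rdiv_le_0_compat.
        * apply Rmult_le_pos; apply pochhammer_ge_0; lra.
        * apply Rmult_lt_0_compat; apply INR_fact_lt_0. }
  rewrite Heq in H; unfold Fser, dFser; lra.
Qed.

(** * Wirtinger derivatives *)

Lemma C_ext (z w : C) : Re z = Re w -> Im z = Im w -> z = w.
Proof. destruct z, w; simpl; intros -> ->; reflexivity. Qed.

Lemma scal_RC (s : R) (w : C) : @scal R_AbsRing C_R_NormedModule s w = (s * w)%C.
Proof. apply C_ext; simpl; unfold scal; simpl; unfold mult; simpl; unfold Re, Im; ring. Qed.

Lemma is_linear_RtoC_mult (a : C) :
  @is_linear R_AbsRing R_NormedModule C_R_NormedModule (fun s : R => (s * a)%C).
Proof.
  apply (is_linear_ext (fun s : R_NormedModule => @scal R_AbsRing C_R_NormedModule s a)).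
  - intros s; apply scal_RC.
  - apply is_linear_scal_l.
Qed.

(** Real differentiability, with the differential in the form h -> A h + B conj(h) that every
    R-linear map of C has. Thus A stands for u_z and B for u_zbar, and the calculus rules can be
    stated for the pair directly. *)
Definition wirtinger_diff (u : C -> C) (z A B : C) : Prop :=
  @filterdiff R_AbsRing C_R_NormedModule C_R_NormedModule u (locally z)
    (fun h : C => (A * h + B * Cconj h)%C).

Lemma wirtinger_diff_Re_Im (u : C -> C) (z A B h : C) :
  wirtinger_diff u z A B ->
  is_derive (fun s : R => Re (u (z + s * h)%C)) 0 (Re (A * h + B * Cconj h)%C) /\
  is_derive (fun s : R => Im (u (z + s * h)%C)) 0 (Im (A * h + B * Cconj h)%C).
Proof.
  intros Hu.
  set (v := fun s : R => u (z + s * h)%C).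
  assert (Hl : @filterdiff R_AbsRing R_NormedModule C_R_NormedModule
    (fun s : R => (z + s * h)%C) (locally 0) (fun s : R => (s * h)%C)).
  { eapply filterdiff_ext_lin.
    - apply (@filterdiff_plus_fct R_AbsRing R_NormedModule C_R_NormedModule _ _
        (fun _ => z) (fun s : R => (s * h)%C)).
      + apply filterdiff_const.
      + apply filterdiff_linear, is_linear_RtoC_mult.
    - intros s; apply plus_zero_l. }
  assert (Hv : @filterdiff R_AbsRing R_NormedModule C_R_NormedModule v (locally 0)
    (fun s => (A * (s * h) + B * Cconj (s * h))%C)).
  { apply (@filterdiff_comp' R_AbsRing R_NormedModule C_R_NormedModule C_R_NormedModule
      (fun s : R => (z + s * h)%C) u 0 _ (fun k : C => (A * k + B * Cconj k)%C) Hl).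
    replace (z + 0 * h)%C with z by ring; exact Hu. }
  split; unfold is_derive.
  - apply (filterdiff_ext_lin _ (fun s : R => fst (A * (s * h) + B * Cconj (s * h))%C)).
    + apply (@filterdiff_comp' R_AbsRing R_NormedModule C_R_NormedModule R_NormedModule
        v fst 0 _ fst Hv).
      apply filterdiff_linear, is_linear_fst.
    + intros s; unfold scal; simpl; unfold mult, Re, Im; simpl; ring.
  - apply (filterdiff_ext_lin _ (fun s : R => snd (A * (s * h) + B * Cconj (s * h))%C)).
    + apply (@filterdiff_comp' R_AbsRing R_NormedModule C_R_NormedModule R_NormedModule
        v snd 0 _ snd Hv).
      apply filterdiff_linear, is_linear_snd.
    + intros s; unfold scal; simpl; unfold mult, Re, Im; simpl; ring.
Qed.

Lemma Derive_shift (f g : R -> R) (x l : R) :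
  (forall s, g s = f (x + s)) -> is_derive g 0 l -> Derive f x = l.
Proof.
  intros Hfg Hg; apply is_derive_unique.
  apply (is_derive_ext (fun y => g (y - x))).
  { intros y; rewrite Hfg; f_equal; ring. }
  rewrite <- (Rmult_1_l l).
  apply (is_derive_comp g (fun y => y - x)).
  - now rewrite Rminus_diag.
  - auto_derive; [exact I|ring].
Qed.

(** Evaluating the differential in the directions 1 and i gives u_x = A + B and u_y = i (A - B),
    which is then solved for A and B. *)
Lemma wirtinger_diff_partials (u : C -> C) (z A B : C) :
  wirtinger_diff u z A B -> d_z u z = A /\ d_zbar u z = B.
Proof.
  intros Hu.
  destruct (wirtinger_diff_Re_Im u z A B 1 Hu) as [Hx1 Hx2].
  destruct (wirtinger_diff_Re_Im u z A B Ci Hu) as [Hy1 Hy2].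
  assert (Hx : partial_x u z = (A + B)%C).
  { replace (A + B)%C with (A * 1 + B * Cconj 1)%C
      by (apply C_ext; unfold Re, Im; simpl; ring).
    apply C_ext; [apply Derive_shift with (2 := Hx1)
                 |apply Derive_shift with (2 := Hx2)];
      intros s; do 2 f_equal; apply C_ext; unfold Re, Im; simpl; ring. }
  assert (Hy : partial_y u z = (Ci * (A - B))%C).
  { replace (Ci * (A - B))%C with (A * Ci + B * Cconj Ci)%C
      by (apply C_ext; unfold Re, Im; simpl; ring).
    apply C_ext; [apply Derive_shift with (2 := Hy1)
                 |apply Derive_shift with (2 := Hy2)];
      intros s; do 2 f_equal; apply C_ext; unfold Re, Im; simpl; ring. }
  unfold d_z, d_zbar; rewrite Hx, Hy.
  split; apply C_ext; unfold Re, Im; simpl; field.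
Qed.

Lemma filterdiff_Cmod2 (z : C) :
  @filterdiff R_AbsRing C_R_NormedModule R_NormedModule (fun w : C => Cmod w ^ 2)
    (locally z) (fun h : C => 2 * (Re z * Re h + Im z * Im h)).
Proof.
  apply (filterdiff_ext (fun w : C_R_NormedModule =>
    plus (mult (fst w : R_AbsRing) (fst w)) (mult (snd w : R_AbsRing) (snd w)))).
  { intros w; rewrite Cmod2_alt; unfold plus, mult; simpl; unfold Re, Im; ring. }
  assert (H1 : @filterdiff R_AbsRing C_R_NormedModule R_NormedModule
    (fun w : C => fst w) (locally z) (fun w : C => fst w))
    by apply filterdiff_linear, is_linear_fst.
  assert (H2 : @filterdiff R_AbsRing C_R_NormedModule R_NormedModule
    (fun w : C => snd w) (locally z) (fun w : C => snd w))
    by apply filterdiff_linear, is_linear_snd.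
  eapply filterdiff_ext_lin.
  - apply (@filterdiff_plus_fct R_AbsRing C_R_NormedModule R_NormedModule _ _
      _ _ _ _ (filterdiff_mult_fct _ _ _ _ _ Rmult_comm H1 H1)
      (filterdiff_mult_fct _ _ _ _ _ Rmult_comm H2 H2)).
  - intros h; unfold plus, mult; simpl; unfold Re, Im; ring.
Qed.

Lemma is_linear_Cmult (a : C) :
  @is_linear R_AbsRing C_R_NormedModule C_R_NormedModule (Cmult a).
Proof.
  apply (is_linear_ext (U := C_R_NormedModule) (V := C_R_NormedModule)
    (fun w : C_R_NormedModule =>
      @plus C_R_NormedModule (RtoC (fst w) * a)%C (RtoC (snd w) * (Ci * a))%C)).
  - intros w; change (RtoC (fst w) * a + RtoC (snd w) * (Ci * a) = a * w)%C.
    apply C_ext; unfold Re, Im; simpl; ring.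
  - apply (@is_linear_comp R_AbsRing C_R_NormedModule
      (prod_NormedModule R_AbsRing C_R_NormedModule C_R_NormedModule) C_R_NormedModule
      (fun w => (RtoC (fst w) * a, RtoC (snd w) * (Ci * a))%C)
      (fun p => plus (fst p) (snd p))); [|apply is_linear_plus].
    apply (@is_linear_prod R_AbsRing C_R_NormedModule C_R_NormedModule C_R_NormedModule
      (fun w => RtoC (fst w) * a)%C (fun w => RtoC (snd w) * (Ci * a))%C).
    + apply (@is_linear_comp R_AbsRing C_R_NormedModule R_NormedModule C_R_NormedModule
        fst (fun s : R => s * a)%C); [apply is_linear_fst|apply is_linear_RtoC_mult].
    + apply (@is_linear_comp R_AbsRing C_R_NormedModule R_NormedModule C_R_NormedModule
        snd (fun s : R => s * (Ci * a))%C); [apply is_linear_snd|apply is_linear_RtoC_mult].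
Qed.

Lemma wirtinger_diff_ext (u v : C -> C) (z A B A' B' : C) :
  (forall w, u w = v w) -> A = A' -> B = B' ->
  wirtinger_diff u z A B -> wirtinger_diff v z A' B'.
Proof. intros Huv -> ->; apply filterdiff_ext, Huv. Qed.

Lemma wirtinger_diff_id (z : C) : wirtinger_diff (fun w => w) z 1 0.
Proof.
  apply (filterdiff_ext_lin _ (fun h : C_R_NormedModule => h)).
  - apply filterdiff_id.
  - intros h; apply C_ext; unfold Re, Im; simpl; ring.
Qed.

Lemma wirtinger_diff_plus (u v : C -> C) (z A B A' B' : C) :
  wirtinger_diff u z A B -> wirtinger_diff v z A' B' ->
  wirtinger_diff (fun w => u w + v w)%C z (A + A') (B + B').
Proof.
  intros Hu Hv.
  eapply filterdiff_ext_lin; [apply (filterdiff_plus_fct _ _ _ _ Hu Hv)|].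
  intros h.
  change (A * h + B * Cconj h + (A' * h + B' * Cconj h)
          = (A + A') * h + (B + B') * Cconj h)%C; ring.
Qed.

Lemma wirtinger_diff_scal (f : C -> R) (u : C -> C) (z A B A' B' : C) (lf : C -> R) :
  @filterdiff R_AbsRing C_R_NormedModule R_NormedModule f (locally z) lf ->
  (forall h, RtoC (lf h) = A * h + B * Cconj h)%C ->
  wirtinger_diff u z A' B' ->
  wirtinger_diff (fun w => RtoC (f w) * u w)%C z (A * u z + f z * A') (B * u z + f z * B').
Proof.
  intros Hf Hl Hu.
  apply (@filterdiff_ext R_AbsRing C_R_NormedModule C_R_NormedModule _ _
    (fun w => @scal R_AbsRing C_R_NormedModule (f w) (u w))); [intros w; apply scal_RC|].
  eapply filterdiff_ext_lin.
  - apply (@filterdiff_scal_fct R_AbsRing C_R_NormedModule C_R_NormedModule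
      z f u _ _ Rmult_comm Hf Hu).
  - intros h; simpl; rewrite !scal_RC, Hl.
    change ((A * h + B * Cconj h) * u z + f z * (A' * h + B' * Cconj h)
      = (A * u z + f z * A') * h + (B * u z + f z * B') * Cconj h)%C; ring.
Qed.

Lemma wirtinger_diff_const (a z : C) : wirtinger_diff (fun _ => a) z 0 0.
Proof.
  eapply filterdiff_ext_lin;
    [apply (@filterdiff_const R_AbsRing C_R_NormedModule C_R_NormedModule _ _ a)|].
  intros h; change (RtoC 0 = 0 * h + 0 * Cconj h)%C; ring.
Qed.

Lemma wirtinger_diff_Cmult (a : C) (u : C -> C) (z A B : C) :
  wirtinger_diff u z A B -> wirtinger_diff (fun w => a * u w)%C z (a * A) (a * B).
Proof.
  intros Hu.
  eapply filterdiff_ext_lin.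
  - apply (@filterdiff_comp' R_AbsRing C_R_NormedModule C_R_NormedModule C_R_NormedModule
      u (Cmult a) z _ (Cmult a) Hu).
    apply filterdiff_linear, is_linear_Cmult.
  - intros h.
    change (a * (A * h + B * Cconj h) = a * A * h + a * B * Cconj h)%C; ring.
Qed.

(** The product rule [wirtinger_diff_scal] needs a real factor, so conj(w) is split as Re w - i Im
    w. The Wirtinger coefficients are (1/2, 1/2) for Re and (-i/2, i/2) for Im. *)
Lemma wirtinger_diff_conj_mult (u : C -> C) (z A B : C) :
  wirtinger_diff u z A B ->
  wirtinger_diff (fun w => Cconj w * u w)%C z (Cconj z * A) (u z + Cconj z * B).
Proof.
  intros Hu.
  assert (Hre := wirtinger_diff_scal Re u z (1 / 2) (1 / 2) A B Re).
  assert (Him := wirtinger_diff_scal Im (fun w => - Ci * u w)%C z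
    (- Ci / 2) (Ci / 2) (- Ci * A) (- Ci * B) Im).
  eapply wirtinger_diff_ext;
    [| | |apply wirtinger_diff_plus; [apply Hre|apply Him]].
  - intros w; apply C_ext; simpl; unfold Re, Im; simpl; ring.
  - apply C_ext; simpl; unfold Re, Im; simpl; field.
  - apply C_ext; simpl; unfold Re, Im; simpl; field.
  - apply filterdiff_linear, is_linear_fst.
  - intros h; apply C_ext; simpl; unfold Re, Im; simpl; field.
  - exact Hu.
  - apply filterdiff_linear, is_linear_snd.
  - intros h; apply C_ext; simpl; unfold Re, Im; simpl; field.
  - apply wirtinger_diff_Cmult, Hu.
Qed.

Lemma wirtinger_diff_conj_pow (z : C) (m : nat) :
  wirtinger_diff (fun w => Cpow (Cconj w) (S m)) z 0 (INR (S m) * Cpow (Cconj z) m).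
Proof.
  induction m as [|m IH].
  - eapply wirtinger_diff_ext;
      [| | |apply (wirtinger_diff_conj_mult _ z _ _ (wirtinger_diff_const 1 z))].
    + intros w; simpl; ring.
    + ring.
    + simpl; ring.
  - eapply wirtinger_diff_ext; [| | |apply (wirtinger_diff_conj_mult _ z _ _ IH)].
    + intros w; reflexivity.
    + ring.
    + rewrite (S_INR (S m)), RtoC_plus, !Cpow_S; ring.
Qed.

(** The differential of |w|^2 at z is conj(z) h + z conj(h); this explains the extra terms with
    [df]. *)
Lemma wirtinger_diff_radial (f : R -> R) (df : R) (u : C -> C) (z A B : C) :
  is_derive f (Cmod z ^ 2)%R df ->
  wirtinger_diff u z A B ->
  wirtinger_diff (fun w => RtoC (f (Cmod w ^ 2)%R) * u w)%C z
    (df * Cconj z * u z + f (Cmod z ^ 2)%R * A)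
    (df * z * u z + f (Cmod z ^ 2)%R * B).
Proof.
  intros Hf Hu.
  apply (wirtinger_diff_scal (fun w => f (Cmod w ^ 2)%R) u z _ _ A B
    (fun h : C => (2 * (Re z * Re h + Im z * Im h)) * df)); [| |exact Hu].
  - apply (@filterdiff_comp' R_AbsRing C_R_NormedModule R_NormedModule R_NormedModule
      (fun w : C => Cmod w ^ 2) f z _ (fun y => y * df) (filterdiff_Cmod2 z) Hf).
  - intros h; apply C_ext; simpl; unfold Re, Im; simpl; ring.
Qed.

(** * The kernel mapping *)

Lemma Cmod_polar (z : C) : exists e : C, Cmod e = 1 /\ z = (Cmod z * e)%C.
Proof.
  destruct (Ceq_dec z 0) as [->|Hz].
  - exists 1; split; [apply Cmod_1|rewrite Cmod_0; ring].
  - assert (Hm : 0 < Cmod z) by now apply Cmod_gt_0.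
    assert (Hm' : RtoC (Cmod z) <> 0) by (intros H; apply RtoC_inj in H; lra).
    exists (z / Cmod z)%C; split; [|field; exact Hm'].
    rewrite Cmod_div, Cmod_R, Rabs_pos_eq by (exact Hm' || lra); field; lra.
Qed.

Lemma Cmod2_minus_polar (p q : R) (e f : C) :
  Cmod e = 1 -> Cmod f = 1 ->
  Cmod (p * e - q * f) ^ 2 = (p - q) ^ 2 + p * q * Cmod (e - f) ^ 2.
Proof.
  intros He Hf.
  assert (He2 := Cmod2_alt e); assert (Hf2 := Cmod2_alt f).
  rewrite He in He2; rewrite Hf in Hf2; rewrite !Cmod2_alt.
  destruct e as [e1 e2], f as [f1 f2]; unfold Re, Im in *; simpl in *.
  (* The difference of the two sides is a combination of |e|^2 - 1 and |f|^2 - 1, both zero. *)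
  apply Rminus_diag_uniq.
  transitivity ((p ^ 2 - p * q) * (e1 ^ 2 + e2 ^ 2 - 1)
                + (q ^ 2 - p * q) * (f1 ^ 2 + f2 ^ 2 - 1)); [ring|].
  simpl; rewrite <- He2, <- Hf2; ring.
Qed.

Lemma Cmod_pow_minus_le (e f : C) (n : nat) :
  Cmod e = 1 -> Cmod f = 1 -> Cmod (e ^ n - f ^ n)%C <= INR n * Cmod (e - f).
Proof.
  intros He Hf; induction n as [|n IH].
  - replace (e ^ 0 - f ^ 0)%C with (RtoC 0) by (simpl; ring).
    rewrite Cmod_0; simpl; lra.
  - replace (e ^ S n - f ^ S n)%C with (e * (e ^ n - f ^ n) + (e - f) * f ^ n)%C
      by (rewrite !Cpow_S; ring).
    eapply Rle_trans; [apply Cmod_triangle|].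
    rewrite !Cmod_mult, Cmod_pow, He, Hf, pow1, S_INR; lra.
Qed.

(** * The radial profiles R_k and their growth *)

Definition radial (a : R) (k : nat) (r : R) : R := Fser a (INR k) (r ^ 2) * r ^ k.

(** The derivative of R_k for k = m + 1, with r^(k - 1) = r^m factored out; the shifted index avoids
    subtraction on [nat]. *)
Definition dradial (a : R) (m : nat) (r : R) : R :=
  r ^ m * (INR (S m) * Fser a (INR (S m)) (r ^ 2)
           + 2 * (r ^ 2 * dFser a (INR (S m)) (r ^ 2))).

Lemma INR_S_ge_1 (m : nat) : 1 <= INR (S m).
Proof. rewrite S_INR; pose proof (pos_INR m); lra. Qed.

Lemma pow2_bounds_01 (r : R) : 0 <= r < 1 -> 0 <= r ^ 2 < 1.
Proof. intros Hr; split; nra. Qed.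

Lemma radial_derive (a r : R) (m : nat) :
  0 < a <= 1 -> 0 <= r < 1 -> is_derive (radial a (S m)) r (dradial a m r).
Proof.
  intros Ha Hr.
  assert (Ht := pow2_bounds_01 r Hr).
  assert (HF : is_derive (Fser a (INR (S m))) (r ^ 2) (dFser a (INR (S m)) (r ^ 2))).
  { apply Fser_derive; [exact Ha|apply INR_S_ge_1|rewrite Rabs_pos_eq; lra]. }
  assert (Hc : is_derive (fun r => Fser a (INR (S m)) (r ^ 2)) r
                 (2 * r * dFser a (INR (S m)) (r ^ 2))).
  { apply (is_derive_comp (Fser a (INR (S m))) (fun r => r ^ 2)); [exact HF|].
    auto_derive; [exact I|ring]. }
  assert (Hp : is_derive (fun r => r ^ S m) r (INR (S m) * r ^ m)).
  { rewrite <- (Rmult_1_r (INR (S m))).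
    apply (is_derive_pow (fun r => r) (S m) r 1), (is_derive_id (K := R_AbsRing)). }
  pose proof (is_derive_mult _ _ r _ _ Hc Hp Rmult_comm) as H.
  replace (dradial a m r) with
    (2 * r * dFser a (INR (S m)) (r ^ 2) * r ^ S m
     + Fser a (INR (S m)) (r ^ 2) * (INR (S m) * r ^ m)); [exact H|].
  unfold dradial; simpl; ring.
Qed.

Lemma radial_1_derive_ge (a r : R) : 0 < a <= 1 -> 0 <= r < 1 ->
  a * Fser a 1 (r ^ 2) <= dradial a 0 r.
Proof.
  intros Ha Hr; assert (Ht := pow2_bounds_01 r Hr).
  pose proof (Fser_1_radial_derive_ge a _ Ha Ht) as H.
  unfold dradial; simpl INR; rewrite pow_O; lra.
Qed.

(** With t = r^2, the bracket k F_k + 2 t F_k' is at most k F_k because F_k' <= 0, and at least - k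
    F_k because k F_k + t F_k' >= 0. Then F_k <= F_1 and r^m <= 1. *)
Lemma dradial_le (a r : R) (m : nat) : 0 < a <= 1 -> 0 <= r < 1 ->
  Rabs (dradial a m r) <= INR (S m) * Fser a 1 (r ^ 2).
Proof.
  intros Ha Hr; assert (Ht := pow2_bounds_01 r Hr); assert (Hk := INR_S_ge_1 m).
  pose proof (Fser_euler_ge_0 a _ _ Ha Hk Ht).
  pose proof (dFser_le_0 a _ _ Ha Hk Ht).
  pose proof (Fser_le_Fser_1 a _ _ Ha Hk Ht).
  assert (Hp : 0 <= r ^ m <= 1).
  { split; [apply pow_le; lra|].
    rewrite <- (pow1 m); apply pow_incr; lra. }
  unfold dradial; rewrite Rabs_mult, (Rabs_pos_eq (r ^ m)) by lra.
  assert (Rabs (INR (S m) * Fser a (INR (S m)) (r ^ 2)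
            + 2 * (r ^ 2 * dFser a (INR (S m)) (r ^ 2)))
          <= INR (S m) * Fser a 1 (r ^ 2)) by (apply Rabs_le; split; nra).
  pose proof (Rabs_pos (INR (S m) * Fser a (INR (S m)) (r ^ 2)
            + 2 * (r ^ 2 * dFser a (INR (S m)) (r ^ 2)))).
  nra.
Qed.

Lemma MVT_derive (f df : R -> R) (s r : R) :
  s <= r -> (forall x, s <= x <= r -> is_derive f x (df x)) ->
  exists x, s <= x <= r /\ f r - f s = df x * (r - s).
Proof.
  intros Hsr Hf.
  destruct (MVT_gen f s r df) as [x [Hx Heq]].
  - intros x; rewrite Rmin_left, Rmax_right by exact Hsr; intros Hx; apply Hf; lra.
  - intros x; rewrite Rmin_left, Rmax_right by exact Hsr; intros Hx.
    apply continuity_pt_filterlim.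
    apply (ex_derive_continuous (V := R_NormedModule)); eexists; apply Hf, Hx.
  - rewrite Rmin_left, Rmax_right in Hx by exact Hsr; now exists x.
Qed.

(** At every x in [0, 1) the derivative is at least a F_1(x^2) >= a (1 - x^2) > 0. *)
Lemma radial_1_increasing (a s r : R) : 0 < a <= 1 -> 0 <= s < r -> r < 1 ->
  radial a 1 s < radial a 1 r.
Proof.
  intros Ha Hs Hr.
  destruct (MVT_derive (radial a 1) (dradial a 0) s r) as [x [Hx Heq]]; [lra| |].
  - intros x Hx; apply radial_derive; [exact Ha|lra].
  - assert (Hx1 : 0 <= x < 1) by lra.
    pose proof (radial_1_derive_ge a x Ha Hx1).
    pose proof (Fser_ge a 1 (x ^ 2) Ha ltac:(lra) (pow2_bounds_01 x Hx1)).
    assert (0 < dradial a 0 x) by (pose proof (pow2_bounds_01 x Hx1); nra).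
    nra.
Qed.

(** The integrated form of a |R_k'| <= k R_1'. *)
Lemma radial_lipschitz (a s r : R) (m : nat) : 0 < a <= 1 -> 0 <= s < 1 -> 0 <= r < 1 ->
  a * Rabs (radial a (S m) r - radial a (S m) s)
  <= INR (S m) * Rabs (radial a 1 r - radial a 1 s).
Proof.
  intros Ha.
  (* With [sg] equal to 1 or -1, this says that k R_1 + a R_k and k R_1 - a R_k are both
     nondecreasing. *)
  assert (Hmono : forall sg s r, Rabs sg = 1 -> 0 <= s <= r -> r < 1 ->
    0 <= INR (S m) * (radial a 1 r - radial a 1 s)
         + sg * a * (radial a (S m) r - radial a (S m) s)).
  { clear s r; intros sg s r Hsg Hs Hr.
    destruct (MVT_derive
      (fun x => INR (S m) * radial a 1 x + sg * a * radial a (S m) x)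
      (fun x => INR (S m) * dradial a 0 x + sg * a * dradial a m x) s r)
      as [x [Hx Heq]]; [lra| |].
    - intros x Hx.
      apply (is_derive_plus (V := R_NormedModule)
        (fun x => INR (S m) * radial a 1 x) (fun x => sg * a * radial a (S m) x));
        apply is_derive_scal; apply radial_derive; lra.
    - pose proof (radial_1_derive_ge a x Ha ltac:(lra)) as H1.
      pose proof (dradial_le a x m Ha ltac:(lra)) as H2.
      pose proof (INR_S_ge_1 m).
      assert (H3 : Rabs (sg * dradial a m x) <= INR (S m) * Fser a 1 (x ^ 2))
        by (rewrite Rabs_mult, Hsg; lra).
      apply Rabs_le_between in H3.
      assert (0 <= INR (S m) * dradial a 0 x + sg * a * dradial a m x) by nra.
      nra. }
  assert (Hle : forall s r, 0 <= s <= r -> r < 1 ->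
    a * Rabs (radial a (S m) r - radial a (S m) s)
    <= INR (S m) * Rabs (radial a 1 r - radial a 1 s)).
  { clear s r; intros s r Hs Hr.
    pose proof (Hmono 1 s r Rabs_R1 Hs Hr).
    pose proof (Hmono (-1) s r ltac:(rewrite Rabs_left; lra) Hs Hr).
    pose proof (INR_S_ge_1 m).
    assert (INR (S m) * (radial a 1 r - radial a 1 s)
            <= INR (S m) * Rabs (radial a 1 r - radial a 1 s))
      by (apply Rmult_le_compat_l; [lra|apply Rle_abs]).
    replace (a * Rabs (radial a (S m) r - radial a (S m) s))
      with (Rabs (a * (radial a (S m) r - radial a (S m) s)))
      by (rewrite Rabs_mult, (Rabs_pos_eq a); lra).
    apply Rabs_le; split; lra. }
  intros Hs Hr; destruct (Rle_dec s r) as [Hsr|Hsr].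
  - apply Hle; lra.
  - rewrite (Rabs_minus_sym (radial a (S m) r)), (Rabs_minus_sym (radial a 1 r)).
    apply Hle; lra.
Qed.

Lemma radial_bounds (a r : R) (m : nat) : 0 < a <= 1 -> 0 <= r < 1 ->
  0 <= radial a (S m) r <= radial a 1 r.
Proof.
  intros Ha Hr; assert (Ht := pow2_bounds_01 r Hr); assert (Hk := INR_S_ge_1 m).
  pose proof (Fser_ge a _ _ Ha Hk Ht).
  pose proof (Fser_le_Fser_1 a _ _ Ha Hk Ht).
  assert (Hp : 0 <= r ^ m <= 1).
  { split; [apply pow_le; lra|].
    rewrite <- (pow1 m); apply pow_incr; lra. }
  assert (0 <= r ^ S m <= r) by (simpl; nra).
  unfold radial; change (INR 1) with 1; rewrite pow_1.
  split; [apply Rmult_le_pos|apply Rmult_le_compat]; lra.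
Qed.

(** * Univalence and Jacobian of the kernel mapping *)

Definition kernel_map (a c : R) (k : nat) (z : C) : C :=
  (RtoC (Fser a 1 (Cmod z ^ 2)) * z
   + RtoC c * RtoC (Fser a (INR k) (Cmod z ^ 2)) * Cpow (Cconj z) k)%C.

Lemma kernel_map_polar (a c r : R) (k : nat) (e : C) : Cmod e = 1 -> 0 <= r ->
  kernel_map a c k (r * e)%C
  = (radial a 1 r * e + c * (radial a k r * Cconj e ^ k))%C.
Proof.
  intros He Hr; unfold kernel_map, radial.
  rewrite Cmod_mult, He, Cmod_R, Rabs_pos_eq, Rmult_1_r by exact Hr.
  rewrite Cmult_conj, Cpow_mult_l.
  replace (Cconj r) with (RtoC r) by (apply C_ext; simpl; ring).
  rewrite pow_1, !RtoC_mult, RtoC_pow; change (INR 1) with 1; ring.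
Qed.

Lemma kernel_map_univalent (a c : R) (m : nat) :
  0 < a <= 1 -> Rabs c * INR (S m) < a -> univalent_on unit_disk (kernel_map a c (S m)).
Proof.
  intros Ha Hc z w Hz Hw Heq; unfold unit_disk in *.
  destruct (Cmod_polar z) as [e [He Hze]], (Cmod_polar w) as [f [Hf Hwf]].
  pose proof (Cmod_ge_0 z) as Hz0; pose proof (Cmod_ge_0 w) as Hw0.
  set (r := Cmod z) in *; set (s := Cmod w) in *.
  rewrite Hze, Hwf, !kernel_map_polar in Heq by assumption.
  (* The equation u(z) = u(w) is rearranged so that the first terms stand against the second ones;
     squared moduli then split into a radial and an angular part on each side. *)
  assert (Hdiff : (radial a 1 r * e - radial a 1 s * f
    = - c * (radial a (S m) r * Cconj e ^ S m - radial a (S m) s * Cconj f ^ S m))%C).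
  { apply (f_equal (fun x => x - radial a 1 s * f
             - c * (radial a (S m) r * Cconj e ^ S m))%C) in Heq.
    ring_simplify in Heq; ring_simplify; exact Heq. }
  apply (f_equal (fun x => Cmod x ^ 2)) in Hdiff.
  rewrite Cmod_mult, Rpow_mult_distr, <- RtoC_opp, Cmod_R, Rabs_Ropp in Hdiff.
  rewrite !Cmod2_minus_polar in Hdiff
    by (rewrite ?Cmod_pow, ?Cmod_conj, ?He, ?Hf, ?pow1; lra).
  assert (Hef : Cmod (Cconj e ^ S m - Cconj f ^ S m)%C <= INR (S m) * Cmod (e - f)).
  { rewrite <- !Cpow_conj, <- Cminus_conj, Cmod_conj; now apply Cmod_pow_minus_le. }
  assert (Hlip := radial_lipschitz a s r m Ha (conj Hw0 Hw) (conj Hz0 Hz)).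
  assert (Hbr := radial_bounds a r m Ha (conj Hz0 Hz)).
  assert (Hbs := radial_bounds a s m Ha (conj Hw0 Hw)).
  pose proof (Cmod_ge_0 (e - f)); pose proof (Cmod_ge_0 (Cconj e ^ S m - Cconj f ^ S m)).
  pose proof (INR_S_ge_1 m); pose proof (Rabs_pos c).
  set (k := INR (S m)) in *.
  set (X := (radial a 1 r - radial a 1 s) ^ 2) in *.
  set (Y := radial a 1 r * radial a 1 s * Cmod (e - f) ^ 2) in *.
  (* The radial part X is compared through the Lipschitz bound, the angular part Y through R_k <=
     R_1, |e^k - f^k| <= k |e - f| and a^2 <= 1. *)
  assert (HX : a ^ 2 * (radial a (S m) r - radial a (S m) s) ^ 2 <= k ^ 2 * X).
  { unfold X; rewrite <- (pow2_abs (_ - _)), <- (pow2_abs (radial a 1 r - _)).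
    rewrite <- !Rpow_mult_distr; apply pow_incr; split; [|exact Hlip].
    apply Rmult_le_pos; [lra|apply Rabs_pos]. }
  assert (HY : a ^ 2 * (radial a (S m) r * radial a (S m) s
      * Cmod (Cconj e ^ S m - Cconj f ^ S m)%C ^ 2) <= k ^ 2 * Y).
  { set (P := radial a (S m) r * radial a (S m) s).
    set (E := Cmod (Cconj e ^ S m - Cconj f ^ S m)%C) in *.
    assert (HP : 0 <= P <= radial a 1 r * radial a 1 s).
    { unfold P; split; [apply Rmult_le_pos|apply Rmult_le_compat]; lra. }
    assert (HE : 0 <= E ^ 2 <= (k * Cmod (e - f)) ^ 2).
    { split; [apply pow2_ge_0|apply pow_incr; lra]. }
    replace (k ^ 2 * Y) with (1 * (radial a 1 r * radial a 1 s * (k * Cmod (e - f)) ^ 2))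
      by (unfold Y; ring).
    apply Rmult_le_compat; [apply pow2_ge_0| |nra|].
    - apply Rmult_le_pos; lra.
    - apply Rmult_le_compat; lra. }
  assert (HX0 : 0 <= X) by apply pow2_ge_0.
  assert (HY0 : 0 <= Y).
  { apply Rmult_le_pos; [apply Rmult_le_pos; lra|apply pow2_ge_0]. }
  assert (Hck : (Rabs c * k) ^ 2 < a ^ 2).
  { assert (0 <= Rabs c * k) by (apply Rmult_le_pos; lra); nra. }
  (* As |c| k < a, this forces X + Y = 0. Then X = 0 gives r = s by monotonicity of R_1, and Y = 0
     gives e = f when r is not 0. *)
  assert (HXY : a ^ 2 * (X + Y) <= (Rabs c * k) ^ 2 * (X + Y)).
  { pose proof (Rmult_le_compat_l _ _ _ (pow2_ge_0 (Rabs c)) (Rplus_le_compat _ _ _ _ HX HY)).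
    rewrite Hdiff at 1; lra. }
  assert (HX' : X = 0) by nra.
  assert (HY' : Y = 0) by nra.
  assert (Hrs : r = s).
  { destruct (Rtotal_order r s) as [Hlt|[Hlt|Hlt]]; [|exact Hlt|].
    - pose proof (radial_1_increasing a r s Ha (conj Hz0 Hlt) Hw); unfold X in HX'; nra.
    - pose proof (radial_1_increasing a s r Ha (conj Hw0 Hlt) Hz); unfold X in HX'; nra. }
  rewrite Hze, Hwf, <- Hrs.
  destruct (Req_dec r 0) as [Hr0|Hr0]; [rewrite Hr0; ring|].
  assert (Hpos : 0 < radial a 1 r).
  { pose proof (Fser_ge a 1 (r ^ 2) Ha ltac:(lra) (pow2_bounds_01 r (conj Hz0 Hz))).
    pose proof (pow2_bounds_01 r (conj Hz0 Hz)).
    unfold radial; change (INR 1) with 1; rewrite pow_1; apply Rmult_lt_0_compat; lra. }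
  unfold Y in HY'; rewrite <- Hrs in HY'.
  assert (Hef0 : Cmod (e - f) = 0) by (apply Rmult_integral in HY'; destruct HY'; nra).
  apply Cmod_eq_0 in Hef0.
  replace e with (f + (e - f))%C by ring; rewrite Hef0; ring.
Qed.

(** The rules above combined, with z conj(z) = t used to gather the factors of t. *)
Lemma kernel_map_wirtinger (a c : R) (m : nat) (z : C) :
  0 < a <= 1 -> Cmod z < 1 ->
  let t := Cmod z ^ 2 in let k := INR (S m) in
  wirtinger_diff (kernel_map a c (S m)) z
    (RtoC (Fser a 1 t + t * dFser a 1 t) + RtoC (c * dFser a k t) * Cconj z ^ S (S m))%C
    (RtoC (dFser a 1 t) * z ^ 2 + RtoC (c * (k * Fser a k t + t * dFser a k t)) * Cconj z ^ m)%C.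
Proof.
  intros Ha Hz t k.
  assert (Ht : 0 <= t < 1) by (apply pow2_bounds_01; split; [apply Cmod_ge_0|exact Hz]).
  assert (Hk := INR_S_ge_1 m); fold k in Hk.
  assert (H1 : wirtinger_diff (fun w => RtoC (Fser a 1 (Cmod w ^ 2)%R) * w)%C z
    (dFser a 1 t * Cconj z * z + Fser a 1 t * 1) (dFser a 1 t * z * z + Fser a 1 t * 0)).
  { apply wirtinger_diff_radial; [|apply wirtinger_diff_id].
    apply Fser_derive; [exact Ha|lra|rewrite Rabs_pos_eq; apply Ht]. }
  assert (H2 := wirtinger_diff_radial (Fser a k) (dFser a k t) _ z _ _
    (Fser_derive a k t Ha Hk ltac:(rewrite Rabs_pos_eq; apply Ht))
    (wirtinger_diff_conj_pow z m)).
  assert (Hzz : (z * Cconj z)%C = RtoC t)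
    by (unfold t; rewrite <- Cmod2_conj, RtoC_pow; reflexivity).
  eapply wirtinger_diff_ext;
    [| | |apply (wirtinger_diff_plus _ _ _ _ _ _ _ H1 (wirtinger_diff_Cmult c _ _ _ _ H2))].
  - intros w; unfold kernel_map; fold k; ring.
  - fold t k; rewrite !RtoC_plus, !RtoC_mult, <- Hzz, !Cpow_S; ring.
  - fold t k; rewrite !RtoC_mult, !RtoC_plus, !RtoC_mult, <- Hzz, !Cpow_S; ring.
Qed.

Lemma kernel_map_sense_preserving (a c : R) (m : nat) :
  0 < a <= 1 -> Rabs c * INR (S m) < a ->
  sense_preserving_on unit_disk (kernel_map a c (S m)).
Proof.
  intros Ha Hc z Hz; unfold unit_disk in Hz.
  pose proof (kernel_map_wirtinger a c m z Ha Hz) as Hu; cbv zeta in Hu.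
  split; [eexists; exact Hu|].
  destruct (wirtinger_diff_partials _ _ _ _ Hu) as [-> ->].
  pose proof (Cmod_ge_0 z) as Hz0.
  assert (Ht := pow2_bounds_01 _ (conj Hz0 Hz)).
  assert (Hk := INR_S_ge_1 m).
  set (r := Cmod z) in *; set (k := INR (S m)) in *.
  pose proof (Fser_euler_ge_0 a k _ Ha Hk Ht) as HE.
  pose proof (Fser_euler_ge_0 a 1 _ Ha ltac:(lra) Ht) as HE1.
  pose proof (dFser_le_0 a k _ Ha Hk Ht) as Hd.
  pose proof (dFser_le_0 a 1 _ Ha ltac:(lra) Ht) as Hd1.
  pose proof (Fser_le_Fser_1 a k _ Ha Hk Ht) as HF.
  pose proof (Fser_ge a k _ Ha Hk Ht) as HF0.
  pose proof (Fser_1_radial_derive_ge a _ Ha Ht) as Hrad.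
  set (t := r ^ 2) in *.
  (* An upper bound for |u_zbar| by the triangle inequality; the signs of F_1' and of k F_k + t F_k'
     remove the absolute values. *)
  apply Rle_lt_trans with (t * - dFser a 1 t + Rabs c * (k * Fser a k t + t * dFser a k t) * r ^ m).
  { eapply Rle_trans; [apply Cmod_triangle|].
    rewrite !Cmod_mult, !Cmod_pow, !Cmod_R, Rabs_mult.
    rewrite (Rabs_left1 (dFser a 1 t)), (Rabs_pos_eq (k * _ + _)), Cmod_conj by assumption.
    fold r t; lra. }
  (* A lower bound for |u_z| by the reverse triangle inequality. *)
  apply Rlt_le_trans with (Fser a 1 t + t * dFser a 1 t - Rabs c * - dFser a k t * r ^ S (S m)).
  2: { set (A := RtoC (Fser a 1 t + t * dFser a 1 t)).
    set (B := (RtoC (c * dFser a k t) * Cconj z ^ S (S m))%C).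
    pose proof (Cmod_triangle (A + B) (- B)) as Htri.
    replace (A + B + - B)%C with A in Htri by ring.
    unfold A in Htri at 1; rewrite Cmod_opp, Cmod_R, Rabs_pos_eq in Htri by lra.
    assert (HB : Cmod B = Rabs c * - dFser a k t * r ^ S (S m)).
    { unfold B; rewrite Cmod_mult, Cmod_R, Cmod_pow, Cmod_conj, Rabs_mult,
        (Rabs_left1 (dFser _ _ _)) by exact Hd.
      reflexivity. }
    lra. }
  assert (Hrm : 0 <= r ^ m <= 1).
  { split; [apply pow_le; lra|].
    rewrite <- (pow1 m); apply pow_incr; lra. }
  (* After this rewriting the F_k' terms of the two bounds cancel, and what remains is |c| k F_k r^m
     < F_1 + 2 t F_1'. *)
  assert (Hpow : r ^ S (S m) = t * r ^ m) by (unfold t; simpl; ring).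
  rewrite Hpow.
  assert (Rabs c * k * (Fser a k t * r ^ m) <= Rabs c * k * Fser a 1 t).
  { apply Rmult_le_compat_l; [|nra].
    apply Rmult_le_pos; [apply Rabs_pos|lra]. }
  assert (Rabs c * k * Fser a 1 t < a * Fser a 1 t) by (apply Rmult_lt_compat_r; lra).
  nra.
Qed.

(** A case split on convergence of the integral covers every real x: a convergent integral of a
    positive function is nonnegative, and otherwise the default value is 0. *)
Lemma Gamma_ge_0 (x : R) : 0 <= Gamma x.
Proof.
  unfold Gamma.
  set (f := fun t => Rpower t (x - 1) * exp (- t)).
  destruct (classic
    (exists l, is_RInt_gen f (at_right 0) (Rbar_locally p_infty) l)) as [[l Hl]|Hn].
  - rewrite (is_RInt_gen_unique _ _ Hl).
    (* With [f] as its own dominating function, the norm estimate for the integral reads |l| <=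
       l. *)
    apply Rle_trans with (norm l); [apply norm_ge_0|].
    apply (RInt_gen_norm (Fa := at_right 0) (Fb := Rbar_locally p_infty) f f); try assumption.
    + exists (fun t => t < 1) (fun t => 1 < t).
      * exists posreal_one; intros y Hy _.
        apply Rabs_lt_between' in Hy; simpl in Hy; lra.
      * now exists 1.
      * intros; simpl; lra.
    + exists (fun _ => True) (fun _ => True); try now apply filter_true.
      intros y z _ _ t _; right; apply Rabs_pos_eq; unfold f.
      apply Rlt_le, Rmult_lt_0_compat; apply exp_pos.
  - (* With no limit, [RInt_gen] is [real (Lub_Rbar setT) = real p_infty = 0]. *)
    right; unfold RInt_gen, iota; cbn; unfold R_complete_lim.
    rewrite (is_lub_Rbar_unique _ p_infty); [reflexivity|].
    split; [now intros|].
    intros [b| |] Hb; [|exact I|].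
    + assert (H : Rbar_le (b + 1) b) by (apply Hb; intros y Hy; elim Hn; now exists y).
      simpl in H; lra.
    + apply (Hb 0); intros y Hy; elim Hn; now exists y.
Qed.

Lemma Fj_Fser (alpha t : R) (j : nat) : Fj alpha j t = Fser (alpha / 2) (INR j) t.
Proof. apply hypergeom_PSeries. Qed.

Theorem theorem4p3 :
  forall (k : nat) (alpha c : R),
    (1 <= k)%nat ->
    0 < alpha <= 2 ->
    let N := alpha /
      (2 * ((INR k - alpha / 2) * Gamma (INR k + 1) * Gamma (2 + alpha / 2)
              / Gamma (INR k + 1 + alpha / 2)
            + INR k)) in
    - N < c < N ->
    let u := fun z : C =>
      (RtoC (Fj alpha 1 (Cmod z ^ 2)) * z
       + RtoC c * RtoC (Fj alpha k (Cmod z ^ 2)) * Cpow (Cconj z) k)%C in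
    sense_preserving_on unit_disk u /\ univalent_on unit_disk u.
Proof.
  intros k alpha c Hk Halpha N Hc u.
  destruct k as [|m]; [lia|].
  (* The Gamma quotient [G] is nonnegative, hence N <= alpha / (2 k). *)
  assert (Hck : Rabs c * INR (S m) < alpha / 2).
  { assert (Hk1 := INR_S_ge_1 m).
    set (G := (INR (S m) - alpha / 2) * Gamma (INR (S m) + 1) * Gamma (2 + alpha / 2)
              / Gamma (INR (S m) + 1 + alpha / 2)) in N.
    assert (HG : 0 <= G).
    { unfold G; apply (Rmult_le_pos _ (/ _)).
      - repeat apply Rmult_le_pos; try apply Gamma_ge_0; lra.
      (* Should the denominator vanish, its inverse is 0 by convention, so the quotient is
         nonnegative in both cases. *)
      - destruct (Gamma_ge_0 (INR (S m) + 1 + alpha / 2)) as [HG|HG].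
        + apply Rlt_le, Rinv_0_lt_compat, HG.
        + rewrite <- HG, Rinv_0; lra. }
    assert (Hlt : Rabs c < N) by (apply Rabs_def1; lra).
    apply Rlt_div_r in Hlt; [|lra].
    pose proof (Rabs_pos c); nra. }
  assert (Hu : u = kernel_map (alpha / 2) c (S m)).
  { apply functional_extensionality; intros z; unfold u, kernel_map.
    now rewrite !Fj_Fser. }
  rewrite Hu; split.
  - apply kernel_map_sense_preserving; lra.
  - apply kernel_map_univalent; lra.
Qed.
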